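(* Fix positive integers $t$ and $u$, and let $\mathcal{H}\subseteq\mathcal{G}^{(t,u)}$ be a set of gridded permutations. The following are equivalent: (1) $\mathcal{H}$ is an interval in the poset $(\mathcal{G}^{(t,u)},\le)$, i.e., for all $a,c\in\mathcal{H}$ and $b\in\mathcal{G}^{(t,u)}$, if $a\le b\le c$ then $b\in\mathcal{H}$; (2) there exists a tiling $\mathcal{T}$ such that $\operatorname{Grid}(\mathcal{T})=\mathcal{H}$.
   Context: A gridded permutation of size $n$ is a pair $(\pi,(c_1,\ldots,c_n))$ where $\pi$ is a permutation of $\{1,\ldots,n\}$ and $c_i=(x_i,y_i)\in\mathbb{N}\times\mathbb{N}$, which is consistent: one can place, for each $i$, a point in the unit square $[x_i,x_i+1)\times[y_i,y_i+1)$ so that the points form the plot of $\pi$ (equivalently, $x_i\le x_j$ whenever $i<j$, and $y_i\le y_j$ whenever $\pi(i)<\pi(j)$). $\mathcal{G}^{(t,u)}$ is the set of gridded permutations all of whose cells lie in $\{0,\ldots,t-1\}\times\{0,\ldots,u-1\}$. A gridded permutation $g=(\pi,(c_1,\ldots,c_n))$ contains $h=(\sigma,(d_1,\ldots,d_k))$, written $h\le g$, if there are indices $i_1<\cdots<i_k$ such that $\pi(i_1)\cdots\pi(i_k)$ is order-isomorphic to $\sigma$ and $c_{i_j}=d_j$ for all $j$ (cells are not standardized). A tiling is a triple $\mathcal{T}=((t,u),\mathcal{O},\mathcal{R})$ where $t,u$ are integers, $\mathcal{O}$ is a set of gridded permutations (obstructions) and $\mathcal{R}=\{\mathcal{R}_1,\ldots,\mathcal{R}_k\}$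 is a set of sets of gridded permutations (requirement lists); these sets may be infinite. $\operatorname{Grid}(\mathcal{T})$ is the set of $g\in\mathcal{G}^{(t,u)}$ that contain no element of $\mathcal{O}$ and, for each $i$, contain at least one element of $\mathcal{R}_i$. *)

(* Defs.v *)
From mathcomp Require Import all_boot all_order all_fingroup all_algebra.
From mathcomp Require Import all_classical.
From mathcomp Require Import lra.

Set Implicit Arguments.
Unset Strict Implicit.
Unset Printing Implicit Defensive.

Import Order.TTheory GRing.Theory Num.Theory.

Local Open Scope classical_set_scope.
Local Open Scope ring_scope.

(* Indices, values and cell coordinates all start at 0. *)
Definition consistent (n : nat) (p : 'S_n) (c : {ffun 'I_n -> nat * nat}) : bool :=
  [forall i : 'I_n, forall j : 'I_n,
    ((i < j)%N ==> ((c i).1 <= (c j).1)%N) &&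
    ((p i < p j)%N ==> ((c i).2 <= (c j).2)%N)].

Record gperm := GPerm {
  gsize : nat;
  gpi : 'S_gsize;
  gcell : {ffun 'I_gsize -> nat * nat};
  gcons : consistent gpi gcell
}.

(* The geometric meaning of consistency: one point can be placed in each
   prescribed half-open unit square so that the points form the plot of [p]. *)
Lemma consistentP (n : nat) (p : 'S_n) (c : {ffun 'I_n -> nat * nat}) :
  reflect (exists P : 'I_n -> rat * rat,
    (forall i, ((c i).1%:R <= (P i).1 < (c i).1%:R + 1) /\
               ((c i).2%:R <= (P i).2 < (c i).2%:R + 1)) /\
    (forall i j, ((P i).1 < (P j).1) = (i < j)%N /\
                 ((P i).2 < (P j).2) = (p i < p j)%N))
  (consistent p c).
Proof.
have low (a b : nat) (x y : rat) :
    a%:R <= x -> x < y -> y < b%:R + 1 -> (a <= b)%N.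
  by move=> ax xy yb; rewrite -ltnS -(ltr_nat rat) -natr1; lra.
have frac (i : 'I_n) : 0 <= (i%:R / n%:R : rat) < 1.
  have n0 : (0 < n)%N by apply: leq_ltn_trans (ltn_ord i).
  by rewrite divr_ge0 ?ler0n//= ltr_pdivrMr ?ltr0n// mul1r ltr_nat.
have mono (a b : nat) (i j : 'I_n) : ((i < j)%N -> (a <= b)%N) ->
    (i < j)%N -> a%:R + i%:R / n%:R < b%:R + j%:R / n%:R :> rat.
  move=> ab ij; have n0 : (0 < n)%N by apply: leq_ltn_trans (ltn_ord i).
  by rewrite ler_ltD ?ler_nat ?ab// ltr_pM2r ?invr_gt0 ?ltr0n// ltr_nat.
have iff (a b : nat) (i j : 'I_n) : ((i < j)%N -> (a <= b)%N) ->
    ((j < i)%N -> (b <= a)%N) -> (i = j -> a = b) ->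
    (a%:R + i%:R / n%:R < b%:R + j%:R / n%:R :> rat) = (i < j)%N.
  move=> ab ba eab; case: (ltngtP i j) => ij; first exact: mono.
  - by apply/negbTE; rewrite -leNgt ltW//; apply: mono.
  - by move/val_inj: ij => ij; rewrite eab// ij ltxx.
apply: (iffP idP) => [/'forall_forallP cc|[P [Pc Po]]].
  exists (fun i => ((c i).1%:R + i%:R / n%:R, (c i).2%:R + (p i)%:R / n%:R)).
  have c1 (i j : 'I_n) : (i < j)%N -> ((c i).1 <= (c j).1)%N.
    by have /andP[/implyP] := cc i j.
  have c2 (i j : 'I_n) : (p i < p j)%N -> ((c i).2 <= (c j).2)%N.
    by have /andP[_ /implyP] := cc i j.
  split=> [i|i j] /=; first by have := frac i; have := frac (p i); lra.
  split; first by apply: iff => [||->//]; exact: c1.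
  by apply: iff => [||/perm_inj ->//]; exact: c2.
apply/'forall_forallP => i j.
have [[/andP[i1 _] /andP[i2 _]] [/andP[_ j1] /andP[_ j2]]] := (Pc i, Pc j).
have [<- <-] := Po i j.
by apply/andP; split; apply/implyP => ij; [apply: low i1 ij j1|apply: low i2 ij j2].
Qed.

Definition gridded_le (h g : gperm) : Prop :=
  exists f : 'I_(gsize h) -> 'I_(gsize g),
    [/\ forall i j : 'I_(gsize h), (i < j)%N -> (f i < f j)%N,
        forall i j, (gpi h i < gpi h j)%N = (gpi g (f i) < gpi g (f j))%N
      & forall i, gcell g (f i) = gcell h i].

Definition gridded (t u : int) : set gperm :=
  [set g | forall i, (gcell g i).1%:Z < t /\ (gcell g i).2%:Z < u].

(* There are finitely many requirement lists, but each of them, as well as the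
   set of obstructions, may be infinite, and none of these gridded permutations
   is required to fit in the dimensions of the tiling. *)
Record tiling := Tiling {
  tcols : int;
  trows : int;
  tobs : set gperm;
  treqs : set (set gperm);
  treqs_finite : finite_set treqs
}.

Definition Grid (T : tiling) : set gperm :=
  [set g | [/\ gridded (tcols T) (trows T) g,
               forall o, tobs T o -> ~ gridded_le o g
             & forall r, treqs T r -> exists2 h, r h & gridded_le h g]].

(* Main.v *)
Require Import Defs.
From mathcomp Require Import all_boot all_order all_fingroup all_algebra.
From mathcomp Require Import all_classical.

Local Open Scope classical_set_scope.
Local Open Scope ring_scope.

(** An interval [H] is cut out by taking as obstructions everything that lies
    below no element of [H], and [H] itself as the only requirement list: a
    gridded permutation avoiding the former lies below some element of [H], and
    one meeting the latter lies above some element of [H]. *)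

Lemma gridded_le_refl (g : gperm) : gridded_le g g.
Proof. by exists id. Qed.

Lemma gridded_le_trans (g h k : gperm) :
  gridded_le h g -> gridded_le g k -> gridded_le h k.
Proof.
move=> [e [e_inc e_iso e_cell]] [f [f_inc f_iso f_cell]].
exists (f \o e); split=> [i j ij|i j|i] /=; first exact/f_inc/e_inc.
- by rewrite e_iso f_iso.
- by rewrite f_cell e_cell.
Qed.

Lemma gridded_le_gridded (t u : int) (h g : gperm) :
  gridded_le h g -> gridded t u g -> gridded t u h.
Proof. by move=> [f [_ _ f_cell]] gG i; rewrite -f_cell; exact: gG. Qed.

(** Fitting in the rectangle and avoiding obstructions pass down from [c]; meeting the requirements
    passes up from [a]. *)
Lemma Grid_interval (T : tiling) (a b c : gperm) :
  Grid T a -> Grid T c -> gridded_le a b -> gridded_le b c -> Grid T b.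
Proof.
move=> [_ _ aR] [cG cO _] ab bc; split=> [|o oO ob|r /aR[h rh ha]].
- exact: gridded_le_gridded bc cG.
- exact: cO oO (gridded_le_trans _ _ _ ob bc).
- by exists h => //; exact: gridded_le_trans ha ab.
Qed.

(** Empty [H] needs no special case: its single requirement list is then empty and cannot be met, so
    the tiling grids nothing. *)
Definition interval_tiling (t u : int) (H : set gperm) : tiling :=
  @Tiling t u [set o | forall c, H c -> ~ gridded_le o c] [set H]
    (finite_set1 H).

Lemma Grid_interval_tiling (t u : int) (H : set gperm) :
  H `<=` gridded t u ->
  (forall a b c : gperm, H a -> H c -> gridded t u b ->
     gridded_le a b -> gridded_le b c -> H b) ->
  Grid (interval_tiling t u H) = H.
Proof.
move=> HG Hint; apply/seteqP; split=> [g [gG gO gR]|g gH].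
  have [a aH ag] := gR H erefl.
  have [c cH gc] : exists2 c, H c & gridded_le g c.
    (* Otherwise [g] would itself be an obstruction, and it contains itself. *)
    apply: contrapT => no_c; apply: (gO g _ (gridded_le_refl g)) => c cH gc.
    by apply: no_c; exists c.
  exact: Hint aH cH gG ag gc.
(* An obstruction lies below no element of [H], so not below [g]; and [g] meets the requirement [H]
   by containing itself. *)
split=> [|o oO|r ->]; [exact: HG|exact: oO|].
by exists g => //; exact: gridded_le_refl.
Qed.

Theorem theorem6p2 (t u : int) (ht : 0 < t) (hu : 0 < u)
    (H : set gperm) (HG : H `<=` gridded t u) :
  (forall a b c : gperm, H a -> H c -> gridded t u b ->
     gridded_le a b -> gridded_le b c -> H b)
  <->
  (exists T : tiling, Grid T = H).
Proof.
split=> [Hint|[T <-] a b c aT cT _]; last exact: Grid_interval.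
by exists (interval_tiling t u H); exact: Grid_interval_tiling.
Qed.
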